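(* For every $p\in(1,\infty)$ there exists a constant $C_p$, depending only on $p$ (in particular not on the dimension $n$), such that for every positive integer $n$, every $d\in[n]$ and every $f\in\mathrm{Deg}_{\le d}$ with $f\colon\{-1,1\}^n\to\{-1,0,1\}$, $$\|\Delta f\|_{L^p(\{-1,1\}^n)}\le C_p\, d\,\|f\|_{L^p(\{-1,1\}^n)}.$$
   Context: Write $[n]=\{1,\dots,n\}$. The Hamming cube $\{-1,1\}^n$ carries the uniform probability measure, and for $p\in[1,\infty)$ and $f\colon\{-1,1\}^n\to\mathbb{C}$, $\|f\|_{L^p(\{-1,1\}^n)}=\left(2^{-n}\sum_{\delta\in\{-1,1\}^n}|f(\delta)|^p\right)^{1/p}$. For $S\subseteq[n]$ the Walsh function is $w_S(\delta)=\prod_{j\in S}\delta_j$, and each $f\colon\{-1,1\}^n\to\mathbb{C}$ has the Fourier--Walsh expansion $f=\sum_{S\subseteq[n]}\widehat f(S)w_S$ with $\widehat f(S)=2^{-n}\sum_{\delta}f(\delta)w_S(\delta)$. $\mathrm{Deg}_{\le d}$ is the space of functions $f\colon\{-1,1\}^n\to\mathbb{C}$ with $\widehat f(S)=0$ whenever $|S|>d$. The Hamming cube Laplacian is $\Delta f=\sum_{j=1}^n\partial_j f$, where $\partial_j f(\delta)=\frac{f(\delta_1,\dots,\delta_j,\dots,\delta_n)-f(\delta_1,\dots,-\delta_j,\dots,\delta_n)}{2}$; equivalently $\Delta f=\sum_{S\subseteq[n]}|S|\,\widehat f(S)\,w_S$. *)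

(* Defs.v *)
From HB Require Import structures.
From mathcomp Require Import all_boot all_order all_algebra.
From mathcomp Require Import reals exp.
From mathcomp Require Import complex.

Set Implicit Arguments.
Unset Strict Implicit.
Unset Printing Implicit Defensive.

Import Order.TTheory GRing.Theory Num.Theory.
Import ComplexField.Normc.

Local Open Scope ring_scope.

(* The bit b stands for the sign (-1) ^+ b, so true encodes -1. *)
Definition cube (n : nat) : finType := {ffun 'I_n -> bool}.

Definition coord (R : realType) (n : nat) (delta : cube n) (j : 'I_n) : R[i] :=
  (-1) ^+ delta j.

Definition flip (n : nat) (j : 'I_n) (delta : cube n) : cube n :=
  [ffun k => if k == j then ~~ delta k else delta k].

Definition walsh (R : realType) (n : nat) (S : {set 'I_n}) (delta : cube n) :
  R[i] := \prod_(j in S) coord R delta j.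

Definition walsh_coef (R : realType) (n : nat) (f : cube n -> R[i])
    (S : {set 'I_n}) : R[i] :=
  (2 ^+ n)^-1 * \sum_(delta : cube n) f delta * walsh R S delta.

Definition Deg_le (R : realType) (n d : nat) (f : cube n -> R[i]) : Prop :=
  forall S : {set 'I_n}, (d < #|S|)%N -> walsh_coef f S = 0.

Definition partial (R : realType) (n : nat) (j : 'I_n) (f : cube n -> R[i])
    (delta : cube n) : R[i] :=
  (f delta - f (flip j delta)) / 2.

Definition laplacian (R : realType) (n : nat) (f : cube n -> R[i])
    (delta : cube n) : R[i] :=
  \sum_(j < n) partial j f delta.

(* normc is the R-valued modulus on R[i]; `|_| would land in R[i]. *)
Definition Lp_norm (R : realType) (n : nat) (p : R) (f : cube n -> R[i]) : R :=
  ((2 ^+ n)^-1 * \sum_(delta : cube n) normc (f delta) `^ p) `^ p^-1.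

(* Main.v *)
(* Write [g] for the real-valued function [f] and [Delta] for the Laplacian.
   The partial derivatives of [g] take values in {0, 1/2, -1/2, 1, -1}, so
   |Delta g| <= sum_j |D_j g| <= 2 sum_j (D_j g)^2, and integrating bounds the
   L^1 norm of [Delta g] by 2 <g, Delta g> <= 2 d |g|_2^2 = 2 d |g|_1.

   For high moments, let R = (1 + h Delta)^-1, a contraction of L^oo by the
   maximum principle.  Iterating Delta = h^-1 (I - R) + Delta (I - R) gives
     Delta = h^-1 sum_(1 <= j <= m) (I - R)^j + Delta (I - R)^m.
   On [g] the first term is at most 2^(m+1) / h pointwise, and the second has
   L^2 norm at most d (h d)^m |g|_2 by Parseval.  With h = 1 / (d t), t >= 1,
   Chebyshev's inequality gives a weak type (2 m + 2) estimate for
   X = |Delta g| / d, hence a bound for the moment of order 2 m + 1.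
   Finally X^p <= X + X^(2 m + 1) as soon as 1 <= p <= 2 m + 1. *)
Require Import Defs.
From mathcomp Require Import all_boot all_order all_algebra.
From mathcomp Require Import reals exp.
From mathcomp Require Import complex.
From mathcomp Require Import ring lra.

Import Order.TTheory GRing.Theory Num.Theory.

Local Open Scope ring_scope.

(** * Walsh analysis of real-valued functions on the cube *)

Lemma flipK {n : nat} (j : 'I_n) : involutive (flip j).
Proof.
move=> x; apply/ffunP => k; rewrite !ffunE.
by case: (k == j); rewrite ?negbK.
Qed.

Lemma sum_flip {R : realType} {n : nat} (j : 'I_n) (F : cube n -> R) :
  \sum_x F (flip j x) = \sum_x F x.
Proof. by rewrite [RHS](reindex_inj (inv_inj (flipK j))). Qed.

(** Real counterparts of the complex notions: the argument rests on order, and [f] takes real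
    values. *)
Definition rwalsh (R : realType) {n : nat} (S : {set 'I_n}) (x : cube n) : R :=
  \prod_(j in S) (-1) ^+ x j.

Definition rcoef {R : realType} {n : nat} (g : cube n -> R) (S : {set 'I_n}) : R :=
  (2 ^+ n)^-1 * \sum_x g x * rwalsh R S x.

Definition rpartial {R : realType} {n : nat} (j : 'I_n) (g : cube n -> R)
    (x : cube n) : R :=
  (g x - g (flip j x)) / 2.

Definition rlap {R : realType} {n : nat} (g : cube n -> R) (x : cube n) : R :=
  \sum_(j < n) rpartial j g x.

(** The operator a(Delta) of the spectral calculus. *)
Definition multiplier {R : realType} {n : nat} (a : nat -> R) (g : cube n -> R)
    (x : cube n) : R :=
  \sum_(S : {set 'I_n}) a #|S| * rcoef g S * rwalsh R S x.

Lemma rwalsh_flip {R : realType} {n : nat} (S : {set 'I_n}) (j : 'I_n)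
    (x : cube n) :
  rwalsh R S (flip j x) = (if j \in S then -1 else 1) * rwalsh R S x.
Proof.
rewrite /rwalsh; case: ifPn => jS; last first.
  rewrite mul1r; apply: eq_bigr => k kS; rewrite ffunE.
  by case: eqP kS => // ->; rewrite (negPf jS).
rewrite (bigD1 j) //= [in RHS](bigD1 j) //= mulrA; congr (_ * _).
  by rewrite ffunE eqxx; case: (x j); rewrite ?expr0 ?expr1; ring.
by apply: eq_bigr => k /andP[_ /negPf kj]; rewrite ffunE kj.
Qed.

(** The sum is the expanded product of the factors 1 + x_j y_j, and a coordinate where the points
    differ gives a zero factor. *)
Lemma rwalsh_complete {R : realType} {n : nat} (x y : cube n) :
  \sum_(S : {set 'I_n}) rwalsh R S x * rwalsh R S y = if x == y then 2 ^+ n else 0.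
Proof.
transitivity (\prod_(j < n) ((-1) ^+ x j * (-1) ^+ y j + 1 : R)).
  rewrite bigA_distr; apply: eq_bigr => S _.
  by rewrite /rwalsh -big_split /= big_mkcond.
case: eqVneq => [<-|neq_xy].
  rewrite (eq_bigr (fun=> 2)) ?prodr_const ?card_ord // => j _.
  by case: (x j); rewrite ?expr0 ?expr1; ring.
have [j xyj] : exists j, x j != y j.
  apply/existsP; apply: contraNT neq_xy => /existsPn xy.
  by apply/eqP/ffunP => j; apply/eqP/negPn.
rewrite (bigD1 j) //=.
by move: xyj; case: (x j); case: (y j) => // _; rewrite ?expr0 ?expr1; ring.
Qed.

(** Flipping a coordinate that lies in exactly one of [S] and [T] permutes the summands but reverses
    their signs. *)
Lemma rwalsh_orthogonal {R : realType} {n : nat} (S T : {set 'I_n}) :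
  \sum_x rwalsh R S x * rwalsh R T x = if S == T then 2 ^+ n else 0.
Proof.
case: eqVneq => [<-|neq_ST].
  rewrite (eq_bigr (fun=> 1)).
    by rewrite sumr_const card_ffun card_bool card_ord natrX.
  move=> x _; rewrite /rwalsh -big_split /= big1 // => j _.
  by case: (x j); rewrite ?expr0 ?expr1; ring.
have [j STj] : exists j, (j \in S) != (j \in T).
  apply/existsP; apply: contraNT neq_ST => /existsPn ST.
  by apply/eqP/setP => j; apply/eqP/negPn.
suff : \sum_x rwalsh R S x * rwalsh R T x = - \sum_x rwalsh R S x * rwalsh R T x.
  by lra.
rewrite -[LHS](sum_flip j) -sumrN; apply: eq_bigr => x _.
rewrite !rwalsh_flip.
by move: STj; case: (j \in S); case: (j \in T) => // _; ring.
Qed.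

(** Walsh inversion, which lets [g] and its Laplacian be handled as multipliers. *)
Lemma multiplier1 {R : realType} {n : nat} (g : cube n -> R) (x : cube n) :
  multiplier (fun=> 1) g x = g x.
Proof.
have N0 : (2 ^+ n : R) != 0 by rewrite expf_neq0 // pnatr_eq0.
transitivity ((2 ^+ n)^-1 *
    \sum_y g y * \sum_(S : {set 'I_n}) rwalsh R S y * rwalsh R S x).
  under [in RHS]eq_bigr do rewrite mulr_sumr.
  rewrite exchange_big mulr_sumr /=; apply: eq_bigr => S _.
  rewrite mul1r /rcoef -mulrA mulr_suml; congr (_ * _).
  by apply: eq_bigr => y _; rewrite mulrA.
rewrite (bigD1 x) //= rwalsh_complete eqxx big1 => [|y yx].
  by rewrite addr0 mulrC mulfK.
by rewrite rwalsh_complete (negPf yx) mulr0.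
Qed.

Lemma rlap_rwalsh (R : realType) {n : nat} (S : {set 'I_n}) (x : cube n) :
  rlap (rwalsh R S) x = #|S|%:R * rwalsh R S x.
Proof.
rewrite -sum1_card natr_sum mulr_suml big_mkcond /=.
apply: eq_bigr => j _; rewrite /rpartial rwalsh_flip.
by case: ifP => _; field.
Qed.

Lemma rlap_multiplier {R : realType} {n : nat} (a : nat -> R) (g : cube n -> R)
    (x : cube n) :
  rlap (multiplier a g) x = multiplier (fun k => k%:R * a k) g x.
Proof.
transitivity (\sum_(S : {set 'I_n}) a #|S| * rcoef g S * rlap (rwalsh R S) x).
  under [RHS]eq_bigr do rewrite mulr_sumr.
  rewrite exchange_big /=; apply: eq_bigr => j _.
  rewrite /rpartial /multiplier -sumrB mulr_suml.
  by apply: eq_bigr => S _; rewrite -mulrBr mulrA.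
by apply: eq_bigr => S _; rewrite rlap_rwalsh; ring.
Qed.

Lemma rlapE {R : realType} {n : nat} (g : cube n -> R) (x : cube n) :
  rlap g x = multiplier (fun k => k%:R) g x.
Proof.
transitivity (rlap (multiplier (fun=> 1) g) x).
  by apply: eq_bigr => j _; rewrite /rpartial !multiplier1.
by rewrite rlap_multiplier; apply: eq_bigr => S _; rewrite mulr1.
Qed.

Lemma parseval {R : realType} {n : nat} (a b : nat -> R) (g : cube n -> R) :
  \sum_x multiplier a g x * multiplier b g x =
  2 ^+ n * \sum_(S : {set 'I_n}) a #|S| * b #|S| * rcoef g S ^+ 2.
Proof.
transitivity (\sum_(S : {set 'I_n}) \sum_(T : {set 'I_n})
    a #|S| * rcoef g S * (b #|T| * rcoef g T) *
    \sum_x rwalsh R S x * rwalsh R T x).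
  under eq_bigr do rewrite big_distrlr /=.
  rewrite exchange_big; apply: eq_bigr => S _ /=.
  rewrite exchange_big; apply: eq_bigr => T _ /=.
  by rewrite mulr_sumr; apply: eq_bigr => x _; ring.
rewrite mulr_sumr; apply: eq_bigr => S _.
rewrite (bigD1 S) //= rwalsh_orthogonal eqxx big1 => [|T TS]; first by ring.
by rewrite rwalsh_orthogonal eq_sym (negPf TS) mulr0.
Qed.

(** Parseval diagonalises the form, and the degree condition leaves only the frequencies up to
    [d]. *)
Lemma multiplier_form_le {R : realType} {n d : nat} (a b : nat -> R) (A : R)
    (g : cube n -> R) :
  (forall S : {set 'I_n}, (d < #|S|)%N -> rcoef g S = 0) ->
  (forall k, (k <= d)%N -> a k * b k <= A) ->
  \sum_x multiplier a g x * multiplier b g x <= A * \sum_x g x ^+ 2.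
Proof.
move=> deg_g leA.
have -> : \sum_x g x ^+ 2 = 2 ^+ n * \sum_(S : {set 'I_n}) rcoef g S ^+ 2.
  transitivity (\sum_x multiplier (fun=> 1) g x * multiplier (fun=> 1) g x).
    by apply: eq_bigr => x _; rewrite multiplier1 expr2.
  by rewrite parseval; congr (_ * _); apply: eq_bigr => S _; rewrite !mul1r.
rewrite parseval mulrCA ler_wpM2l ?exprn_ge0 // mulr_sumr ler_sum // => S _.
have [/leA|/deg_g ->] := leqP #|S| d; last by rewrite expr0n !mulr0.
by move=> abA; rewrite ler_wpM2r ?sqr_ge0.
Qed.

(** * The resolvent of the Laplacian and powers of its Yosida approximation *)

(* At a maximum point of [u] the Laplacian of [u] is nonnegative. *)
Lemma resolvent_le {R : realType} {n : nat} (h K : R) (u : cube n -> R) :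
  0 <= h -> (forall x, u x + h * rlap u x <= K) -> forall x, u x <= K.
Proof.
move=> h0 leK x0.
case: (@Order.TotalTheory.arg_maxP _ _ _ x0 predT u isT) => x _ max_x.
apply: le_trans (max_x x0 isT) _; apply: le_trans (leK x).
rewrite lerDl mulr_ge0 // sumr_ge0 // => j _.
by rewrite divr_ge0 // subr_ge0; exact: max_x.
Qed.

(** The one-sided bound applies to [u] and to [- u]; thus (1 + h Delta)^-1 contracts the sup
    norm. *)
Lemma resolvent_norm_le {R : realType} {n : nat} (h K : R) (u : cube n -> R) :
  0 <= h -> (forall x, `|u x + h * rlap u x| <= K) -> forall x, `|u x| <= K.
Proof.
move=> h0 leK x; rewrite ler_norml; apply/andP; split.
  rewrite lerNl; move: x; apply: (resolvent_le h) => // x.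
  suff -> : rlap (fun y => - u y) x = - rlap u x.
    by rewrite mulrN -opprD (le_trans _ (leK x)) // -normrN ler_norm.
  by rewrite -sumrN; apply: eq_bigr => j _; rewrite /rpartial; field.
move: x; apply: (resolvent_le h) => // x.
by rewrite (le_trans _ (leK x)) // ler_norm.
Qed.

(* The multiplier of [h Delta (1 + h Delta)^-1]. *)
Definition yosida {R : realType} (h : R) (k : nat) : R :=
  h * k%:R / (1 + h * k%:R).

Lemma multiplierD {R : realType} {n : nat} (a b : nat -> R) (c : R)
    (g : cube n -> R) (x : cube n) :
  multiplier (fun k => a k + c * b k) g x =
  multiplier a g x + c * multiplier b g x.
Proof.
by rewrite mulr_sumr -big_split; apply: eq_bigr => S _ /=; ring.
Qed.

Lemma eq_multiplier {R : realType} {n : nat} (a b : nat -> R)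
    (g : cube n -> R) (x : cube n) :
  a =1 b -> multiplier a g x = multiplier b g x.
Proof. by move=> ab; apply: eq_bigr => S _; rewrite ab. Qed.

(** The multiplier is (I - R)^j with R = (1 + h Delta)^-1; as R contracts the sup norm, each factor
    I - R costs at most 2. *)
Lemma yosida_norm_le {R : realType} {n : nat} (h : R) (j : nat)
    (g : cube n -> R) :
  0 < h -> (forall x, `|g x| <= 1) ->
  forall x, `|multiplier (fun k => yosida h k ^+ j) g x| <= 2 ^+ j.
Proof.
move=> h0 g1; elim: j => [|j IHj] x.
  by rewrite (eq_multiplier _ (fun=> 1)) => [|k]; rewrite ?multiplier1 expr0 ?g1.
have den0 k : 1 + h * k%:R != 0.
  by rewrite gt_eqF // ltr_pwDl // mulr_ge0 // ltW.
(* [w] is R applied to the current iterate, so the next iterate is the current one minus [w]. *)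
pose w := multiplier (fun k => yosida h k ^+ j / (1 + h * k%:R)) g.
have wE y : w y + h * rlap w y = multiplier (fun k => yosida h k ^+ j) g y.
  rewrite rlap_multiplier -multiplierD; apply: eq_multiplier => k.
  by field; exact: den0.
have w_le : `|w x| <= 2 ^+ j.
  by apply: (resolvent_norm_le h) => [|y]; [exact: ltW | rewrite wE].
have -> : multiplier (fun k => yosida h k ^+ j.+1) g x =
    multiplier (fun k => yosida h k ^+ j) g x + -1 * w x.
  rewrite -multiplierD; apply: eq_multiplier => k.
  by rewrite exprS /yosida; field; exact: den0.
rewrite mulN1r (le_trans (ler_normB _ _)) // exprS mulr2n mulrDl mul1r.
by rewrite lerD.
Qed.

(** Telescoping: k y^m = k y^(m+1) + y^(m+1) / h for y = [yosida h k], and 2 + ... + 2^m = 2^(m+1) -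
    2. *)
Lemma rlap_sub_yosida_norm_le {R : realType} {n : nat} (h : R) (m : nat)
    (g : cube n -> R) (x : cube n) :
  0 < h -> (forall x, `|g x| <= 1) ->
  `|rlap g x - multiplier (fun k => k%:R * yosida h k ^+ m) g x| <=
  h^-1 * (2 ^+ m.+1 - 2).
Proof.
move=> h0 g1; elim: m => [|m IHm].
  rewrite rlapE (eq_multiplier _ (fun k => k%:R)) => [|k]; last by rewrite mulr1.
  by rewrite subrr normr0 expr1 subrr mulr0.
have den0 k : 1 + h * k%:R != 0.
  by rewrite gt_eqF // ltr_pwDl // mulr_ge0 // ltW.
have split_k : multiplier (fun k => k%:R * yosida h k ^+ m) g x =
    multiplier (fun k => k%:R * yosida h k ^+ m.+1) g x +
    h^-1 * multiplier (fun k => yosida h k ^+ m.+1) g x.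
  rewrite -multiplierD; apply: eq_multiplier => k.
  by rewrite exprS /yosida; field; rewrite den0 gt_eqF.
have -> : rlap g x - multiplier (fun k => k%:R * yosida h k ^+ m.+1) g x =
    (rlap g x - multiplier (fun k => k%:R * yosida h k ^+ m) g x) +
    h^-1 * multiplier (fun k => yosida h k ^+ m.+1) g x.
  by rewrite split_k; ring.
apply: le_trans (ler_normD _ _) _.
have -> : h^-1 * (2 ^+ m.+2 - 2) =
    h^-1 * (2 ^+ m.+1 - 2) + h^-1 * 2 ^+ m.+1 :> R by rewrite !exprS; ring.
have h0i : 0 <= h^-1 by rewrite invr_ge0 ltW.
rewrite lerD // normrM ger0_norm // ler_wpM2l //.
exact: yosida_norm_le.
Qed.

(** On the frequencies k <= d one has 0 <= [yosida h k] <= h k <= h d. *)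
Lemma yosida_remainder_le {R : realType} {n d : nat} (h : R) (m : nat)
    (g : cube n -> R) :
  0 < h -> (forall S : {set 'I_n}, (d < #|S|)%N -> rcoef g S = 0) ->
  \sum_x multiplier (fun k => k%:R * yosida h k ^+ m) g x ^+ 2 <=
  (d%:R * (h * d%:R) ^+ m) ^+ 2 * \sum_x g x ^+ 2.
Proof.
move=> h0 deg_g; under eq_bigr do rewrite expr2.
apply: multiplier_form_le deg_g _ => k kd; rewrite -expr2.
have hk0 l : 0 <= h * l%:R by rewrite mulr_ge0 // ltW.
have y0 : 0 <= yosida h k by rewrite divr_ge0 // addr_ge0.
apply: lerXn2r; rewrite ?nnegrE ?mulr_ge0 ?exprn_ge0 //.
rewrite ler_pM ?exprn_ge0 ?ler_nat //; apply: lerXn2r; rewrite ?nnegrE //.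
apply: (@le_trans _ _ (h * k%:R)).
  by rewrite ler_pdivrMr ?ltr_pwDl // ler_peMr // lerDl.
by rewrite ler_wpM2l ?ler_nat // ltW.
Qed.

(** * The L^1 bound, from the discreteness of the values *)

(** [rpartial j] is a self-adjoint projection: averaging the right-hand summand over [x] and
    [flip j x] produces the square. *)
Lemma sum_rpartial_sqr {R : realType} {n : nat} (j : 'I_n) (g : cube n -> R) :
  \sum_x rpartial j g x ^+ 2 = \sum_x g x * rpartial j g x.
Proof.
transitivity (\sum_x (g x * rpartial j g x +
    g (flip j x) * rpartial j g (flip j x)) / 2).
  by apply: eq_bigr => x _; rewrite /rpartial flipK; field.
rewrite -mulr_suml big_split /=.
by rewrite (sum_flip j (fun x => g x * rpartial j g x)); field.
Qed.

Lemma sum_norm_rlap_le {R : realType} {n d : nat} (g : cube n -> R) :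
  (forall S : {set 'I_n}, (d < #|S|)%N -> rcoef g S = 0) ->
  (forall x, [\/ g x = -1, g x = 0 | g x = 1]) ->
  \sum_x `|rlap g x| <= 2 * d%:R * \sum_x g x ^+ 2.
Proof.
move=> deg_g g3.
(* The partial derivative is a multiple of 1/2, so its modulus is at least 1/2 unless it
   vanishes. *)
have le_sqr j x : `|rpartial j g x| <= 2 * rpartial j g x ^+ 2.
  rewrite /rpartial ler_norml.
  by case: (g3 x) => ->; case: (g3 (flip j x)) => ->; apply/andP; split; lra.
apply: (@le_trans _ _ (2 * \sum_x g x * rlap g x)).
  apply: (@le_trans _ _ (\sum_x \sum_(j < n) 2 * rpartial j g x ^+ 2)).
    apply: ler_sum => x _; apply: le_trans (ler_norm_sum _ _ _) _.
    exact: ler_sum.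
  rewrite exchange_big mulr_sumr /=.
  under eq_bigr do rewrite -mulr_sumr sum_rpartial_sqr mulr_sumr.
  rewrite exchange_big /=; apply: ler_sum => x _.
  by rewrite -mulr_sumr -mulr_sumr.
rewrite -mulrA ler_pM2l //.
(* The form <g, Delta g> has symbols 1 and k, with product at most d on the frequencies of [g]. *)
rewrite (eq_bigr (fun x => multiplier (fun=> 1) g x *
    multiplier (fun k => k%:R) g x)) => [|x _]; last by rewrite multiplier1 rlapE.
by apply: multiplier_form_le deg_g _ => k kd; rewrite mul1r ler_nat.
Qed.

(** * High moments by dyadic decomposition *)

(* The hypotheses say that [X] is of weak type [2 * m + 4], which is more than
   the exponent [2 * m + 3] of the moment. *)
Lemma moment_le {R : realType} {T : finType} (K G : R) (m : nat) (X : T -> R)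
    (Y : nat -> T -> R) :
  1 <= K -> 0 <= G -> (forall x, 0 <= X x) ->
  (forall i x, X x <= K * 2 ^+ i + `|Y i x|) ->
  (forall i, \sum_x Y i x ^+ 2 <= 2^-1 ^+ i ^+ (2 * m + 2) * G) ->
  \sum_x X x ^+ (2 * m + 3) <=
  (2 * K) ^+ (2 * m + 2) * \sum_x X x + 8 * (4 * K) ^+ (2 * m + 1) * G.
Proof.
move=> K1 G0 X0 XY sumY.
have K0 : 0 <= K by rewrite (le_trans _ K1).
(* As [T] is finite, [X] stays below 2 K 2^N, so finitely many dyadic shells suffice. *)
pose N := \max_x Num.bound (X x).
pose c i := 4 * (4 * K * 2 ^+ i) ^+ (2 * m + 1) : R.
have c0 i : 0 <= c i by rewrite mulr_ge0 ?exprn_ge0 ?mulr_ge0 ?exprn_ge0.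
(* Below 2 K the linear term suffices. On the shell 2 K 2^M <= X < 4 K 2^M the decomposition at i =
   M gives X <= 2 |Y_M|, so X^(2m+3) = X^(2m+1) X^2 is at most [c M] times Y_M^2. *)
have pointwise M x : X x < 2 * K * 2 ^+ M ->
    X x ^+ (2 * m + 3) <=
    (2 * K) ^+ (2 * m + 2) * X x + \sum_(i < M) c i * Y i x ^+ 2.
  elim: M => [|M IHM] ltM.
    rewrite big_ord0 addr0 addnS exprSr ler_wpM2r //.
    apply: lerXn2r; rewrite ?nnegrE ?mulr_ge0 //.
    by rewrite -[2 * K]mulr1 ltW.
  rewrite big_ord_recr /= addrA.
  have cY0 i : 0 <= c i * Y i x ^+ 2 by rewrite mulr_ge0 ?sqr_ge0.
  have [/IHM leM|geM] := ltP (X x) (2 * K * 2 ^+ M).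
    by rewrite (le_trans leM) // lerDl.
  rewrite -[leLHS]add0r lerD //.
    by rewrite addr_ge0 ?mulr_ge0 ?exprn_ge0 ?mulr_ge0 // sumr_ge0.
  have leY : X x <= 2 * `|Y M x| by have := XY M x; lra.
  have -> : (2 * m + 3 = 2 * m + 1 + 2)%N by rewrite -addnA.
  rewrite exprD /c -[leRHS]mulrA [leRHS]mulrCA.
  rewrite ler_pM ?exprn_ge0 //.
    apply: lerXn2r; rewrite ?nnegrE ?mulr_ge0 ?exprn_ge0 //.
    by rewrite exprS in ltM; lra.
  rewrite -[Y M x ^+ 2]real_normK ?num_real // (_ : 4 = 2 ^+ 2) -?exprMn.
    by apply: lerXn2r; rewrite ?nnegrE ?mulr_ge0.
  by rewrite expr2 -natrM.
have ltN x : X x < 2 * K * 2 ^+ N.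
  have : X x < 2 ^+ N by apply: upper_nthrootP; rewrite /N (leq_bigmax x).
  by move/lt_le_trans; apply; rewrite ler_peMl ?exprn_ge0 //; lra.
apply: le_trans (ler_sum _ (fun x _ => pointwise N x (ltN x))) _.
rewrite big_split /= -mulr_sumr lerD2l exchange_big /=.
(* The decay 2^(-i(2m+2)) beats the growth 2^(i(2m+1)) of [c i] by a factor 2^(-i), and the
   geometric series sums to at most 2. *)
apply: (@le_trans _ _ (\sum_(i < N) 4 * (4 * K) ^+ (2 * m + 1) * G * 2^-1 ^+ i)).
  apply: ler_sum => i _; rewrite -mulr_sumr.
  apply: le_trans (ler_wpM2l (c0 i) (sumY i)) _.
  rewrite /c le_eqVlt; apply/orP; left; apply/eqP.
  rewrite exprMn [(2 * m + 2)%N]addnS exprSr.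
  have -> : (2 ^+ i) ^+ (2 * m + 1) = (2^-1 ^+ i ^+ (2 * m + 1))^-1 :> R.
    by rewrite !exprVn invrK.
  field.
  by rewrite !expf_neq0 ?invr_eq0 ?pnatr_eq0.
rewrite -mulr_sumr.
suff geo M : \sum_(i < M) 2^-1 ^+ i = 2 - 2 * 2^-1 ^+ M :> R.
  have -> : 8 * (4 * K) ^+ (2 * m + 1) * G =
      4 * (4 * K) ^+ (2 * m + 1) * G * 2 :> R by ring.
  rewrite ler_wpM2l ?mulr_ge0 ?exprn_ge0 ?mulr_ge0 // geo.
  by rewrite gerBl mulr_ge0 ?exprn_ge0 ?invr_ge0.
by elim: M => [|M IHM]; rewrite ?big_ord0 ?big_ord_recr /= ?IHM ?exprS ?expr0; field.
Qed.

Lemma moment_rlap_le {R : realType} {n d : nat} (m : nat) (g : cube n -> R) :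
  (0 < d)%N ->
  (forall S : {set 'I_n}, (d < #|S|)%N -> rcoef g S = 0) ->
  (forall x, [\/ g x = -1, g x = 0 | g x = 1]) ->
  \sum_x (`|rlap g x| / d%:R) ^+ (2 * m + 3) <=
  (2 * (2 * 2 ^+ m.+2) ^+ (2 * m + 2) + 8 * (4 * 2 ^+ m.+2) ^+ (2 * m + 1)) *
  \sum_x g x ^+ 2.
Proof.
move=> d0 deg_g g3; set K : R := 2 ^+ m.+2; set G := \sum_x g x ^+ 2.
have dR0 : 0 < d%:R :> R by rewrite ltr0n.
have dRn0 : d%:R != 0 :> R by rewrite gt_eqF.
(* With m + 1 Yosida steps, this [h i] makes the bounded part at most d K 2^i and the factor (h
   d)^(m+1) of the remainder equal to 2^(-i(m+1)). *)
pose h i : R := (d%:R * 2 ^+ i)^-1.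
have h0 i : 0 < h i by rewrite invr_gt0 mulr_gt0 ?exprn_gt0.
pose B i := multiplier (fun k => k%:R * yosida (h i) k ^+ m.+1) g.
have g1 x : `|g x| <= 1.
  by case: (g3 x) => ->; rewrite ?normrN ?normr1 ?normr0.
have K0 : 0 <= K :> R by rewrite exprn_ge0.
have leX i x : `|rlap g x| / d%:R <= K * 2 ^+ i + `|B i x / d%:R|.
  rewrite normrM normfV [`|d%:R|]gtr0_norm // ler_pdivrMr // mulrDl mulfVK //.
  rewrite -lerBlDr (le_trans (lerB_dist _ _)) //.
  apply: le_trans (rlap_sub_yosida_norm_le _ _ _ _ (h0 i) g1) _.
  rewrite invrK (_ : K * 2 ^+ i * d%:R = d%:R * 2 ^+ i * K); last by ring.
  by rewrite ler_wpM2l ?mulr_ge0 ?exprn_ge0 // gerBl.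
have sumB i : \sum_x (B i x / d%:R) ^+ 2 <= 2^-1 ^+ i ^+ (2 * m + 2) * G.
  under eq_bigr do rewrite expr_div_n.
  rewrite -mulr_suml ler_pdivrMr ?exprn_gt0 //.
  apply: le_trans (yosida_remainder_le _ _ _ (h0 i) deg_g) _.
  rewrite (_ : h i * d%:R = 2^-1 ^+ i); last first.
    by rewrite /h exprVn; field; rewrite dRn0 expf_neq0 ?pnatr_eq0.
  rewrite (_ : (2 * m + 2 = m.+1 * 2)%N); last by rewrite -[RHS]mulnC mulnS addnC.
  by rewrite [leRHS]mulrC [2^-1 ^+ i ^+ (_ * 2)]exprM mulrA exprMn.
apply: le_trans (moment_le K G m _ _ _ _ _ leX sumB) _.
- by rewrite exprn_ege1 // ler1n.
- by apply: sumr_ge0 => x _; exact: sqr_ge0.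
- by move=> x; rewrite divr_ge0.
(* The linear term left by the dyadic argument is controlled by the L^1 bound. *)
rewrite [leRHS]mulrDl lerD2r -[leRHS]mulrA [leRHS]mulrCA.
apply: ler_wpM2l; first by apply: exprn_ge0; apply: mulr_ge0.
rewrite -mulr_suml ler_pdivrMr // mulrAC.
exact: sum_norm_rlap_le.
Qed.

(** * Real exponents, and the passage from complex to real functions *)

Lemma powR_le_addX {R : realType} (p t : R) (q : nat) :
  1 <= p <= q%:R -> 0 <= t -> t `^ p <= t + t ^+ q.
Proof.
move=> /andP[p1 pq] t0; have [t1|t1] := leP 1 t.
  by rewrite (le_trans (ler_powR t1 pq)) // powR_mulrn // lerDr.
apply: (@le_trans _ _ t); last by rewrite lerDl exprn_ge0.
move: t0; rewrite le_eqVlt => /predU1P[<-|t0].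
  by rewrite powR0 // gt_eqF // (lt_le_trans _ p1).
by rewrite ge1r_powR // t0 ltW.
Qed.

Lemma normc_real {R : realType} (r : R) :
  ComplexField.Normc.normc (real_complex R r) = `|r|.
Proof. by rewrite /= expr0n addr0 sqrtr_sqr. Qed.

Lemma laplacian_real {R : realType} {n : nat} (g : cube n -> R) (x : cube n) :
  laplacian (fun y => real_complex R (g y)) x = real_complex R (rlap g x).
Proof.
rewrite /laplacian /rlap rmorph_sum; apply: eq_bigr => j _.
by rewrite /partial /rpartial rmorphM rmorphB fmorphV rmorph_nat.
Qed.

Lemma walsh_coef_real {R : realType} {n : nat} (g : cube n -> R) (S : {set 'I_n}) :
  walsh_coef (fun y => real_complex R (g y)) S = real_complex R (rcoef g S).
Proof.
rewrite /walsh_coef /rcoef rmorphM fmorphV rmorphXn rmorph_nat rmorph_sum.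
congr (_ * _); apply: eq_bigr => x _; rewrite rmorphM rmorph_prod.
by congr (_ * _); apply: eq_bigr => j _; rewrite rmorphXn rmorphN1.
Qed.

Theorem corollary1p5 (R : realType) (p : R) (hp : 1 < p) :
  exists C : R,
    forall (n d : nat) (f : cube n -> R[i]),
      (0 < n)%N -> (1 <= d <= n)%N ->
      Deg_le d f ->
      (forall delta : cube n,
          [\/ f delta = -1, f delta = 0 | f delta = 1]) ->
      Lp_norm p (laplacian f) <= C * d%:R * Lp_norm p f.
Proof.
have p0 : 0 < p by rewrite (lt_trans _ hp).
have pn0 : p != 0 by rewrite gt_eqF.
(* This choice gives p < m <= 2 m + 3, so X^p <= X + X^(2m+3). In [C], the 2 comes from the L^1
   bound and the rest from the moment bound. *)
pose m := Num.bound p; pose K : R := 2 ^+ m.+2.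
pose C : R := 2 + (2 * (2 * K) ^+ (2 * m + 2) + 8 * (4 * K) ^+ (2 * m + 1)).
have K0 : 0 <= K by rewrite exprn_ge0.
have C0 : 0 <= C.
  by rewrite addr_ge0 // addr_ge0 // mulr_ge0 // exprn_ge0 // mulr_ge0.
(* [C] bounds the p-th moment, hence the root. *)
exists (C `^ p^-1) => n d f _ /andP[d0 _] deg_f f3.
pose g x := complex.Re (f x).
have fE x : f x = real_complex R (g x).
  by rewrite /g; case: (f3 x) => ->; rewrite /= ?rmorphN1 ?rmorph0 ?rmorph1.
have g3 x : [\/ g x = -1, g x = 0 | g x = 1].
  by rewrite /g; case: (f3 x) => ->;
    [constructor 1|constructor 2|constructor 3] => //=.
have lapE x : laplacian f x = real_complex R (rlap g x).
  by rewrite -laplacian_real; apply: eq_bigr => j _; rewrite /partial !fE.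
have deg_g (S : {set 'I_n}) : (d < #|S|)%N -> rcoef g S = 0.
  move=> /deg_f fS; apply: complexI; rewrite rmorph0 -fS -walsh_coef_real.
  by congr (_ * _); apply: eq_bigr => x _; rewrite fE.
have dR0 : 0 < d%:R :> R by rewrite ltr0n.
set G := \sum_x g x ^+ 2.
(* The modulus of [f] is 0 or 1, so its p-th power equals its square. *)
have sum_f : \sum_x ComplexField.Normc.normc (f x) `^ p = G.
  apply: eq_bigr => x _; rewrite fE normc_real.
  by case: (g3 x) => ->; rewrite ?normrN ?normr1 ?normr0 ?powR1 ?powR0 //; ring.
have sum_lap : \sum_x ComplexField.Normc.normc (laplacian f x) `^ p <=
    d%:R `^ p * (C * G).
  pose X x := `|rlap g x| / d%:R.
  have X0 x : 0 <= X x by rewrite divr_ge0.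
  have -> : \sum_x ComplexField.Normc.normc (laplacian f x) `^ p =
      d%:R `^ p * \sum_x X x `^ p.
    rewrite mulr_sumr; apply: eq_bigr => x _.
    by rewrite lapE normc_real -powRM ?(ltW dR0) // mulrC divfK // gt_eqF.
  rewrite ler_wpM2l ?powR_ge0 // [leRHS]mulrDl.
  have pq : 1 <= p <= (2 * m + 3)%:R.
    rewrite ltW //= (le_trans (ltW (archi_boundP (ltW p0)))) // ler_nat.
    by rewrite -/m mul2n -addnn -addnA leq_addr.
  apply: le_trans (ler_sum _ (fun x _ => powR_le_addX _ _ _ pq (X0 x))) _.
  rewrite big_split lerD //=; last exact: moment_rlap_le.
  rewrite -mulr_suml ler_pdivrMr // mulrAC.
  exact: sum_norm_rlap_le.
have G0 : 0 <= G by apply: sumr_ge0 => x _; exact: sqr_ge0.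
have N0 : 0 <= (2 ^+ n)^-1 :> R by rewrite invr_ge0 exprn_ge0.
rewrite /Lp_norm sum_f.
apply: (@le_trans _ _ ((C * (d%:R `^ p * ((2 ^+ n)^-1 * G))) `^ p^-1)).
  apply: ge0_ler_powR; rewrite ?nnegrE ?invr_ge0 ?(ltW p0) //.
  - by rewrite mulr_ge0 // sumr_ge0 // => x _; rewrite powR_ge0.
  - by rewrite !mulr_ge0 ?powR_ge0.
  apply: le_trans (ler_wpM2l N0 sum_lap) _.
  by rewrite le_eqVlt; apply/orP; left; apply/eqP; ring.
rewrite !powRM ?mulr_ge0 ?powR_ge0 //.
by rewrite -powRrM mulfV // powRr1 ?(ltW dR0) // mulrA.
Qed.
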